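(* Let $\alpha,\beta,\gamma,\mu,\nu,\kappa$ be constants with $\nu=\alpha=\beta=\gamma=0$. Then the equation for the profile $H$ of travelling wave solutions $u(x,t)=H(x-Dt)$ of the partial differential equation $$u_{tt}=(\kappa u+\gamma u^2)_{xx}+\nu u u_{xxxx}+\mu u_{xxtt}+\alpha u_xu_{xxx}+\beta u_{xx}^2$$ becomes the linear equation $\mu D^2H^{(4)}+(\kappa-D^2)H''=0$, whose solution is $$H(x-Dt)=C_1\sin\left(\sqrt{\frac{\kappa-D^2}{\mu D^2}}\,(x-Dt)\right)+C_2\cos\left(\sqrt{\frac{\kappa-D^2}{\mu D^2}}\,(x-Dt)\right),$$ where $C_1$ and $C_2$ are arbitrary constants. Hence the solution of the partial differential equation is $$u(x,t)=C_1\sin\left(\sqrt{\frac{\kappa-D^2}{\mu D^2}}\,(x-Dt)\right)+C_2\cos\left(\sqrt{\frac{\kappa-D^2}{\mu D^2}}\,(x-Dt)\right).$$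
   Context: Subscripts denote partial derivatives of $u=u(x,t)$. Solutions are sought in travelling wave form $u(x,t)=H(x-Dt)$, where $D$ is a constant phase velocity; primes and $H^{(4)}$ denote derivatives of $H$ with respect to its argument $x-Dt$.
   Formalization: Taken over real C^4 functions with μ, D nonzero and (κ−D²)/(μD²) ≥ 0, so the root is real. The sine/cosine family is not the general solution (H=1 also solves the equation): for a positive radicand the general solution is that family plus an affine term A+B(x−Dt). *)

(* Defs.v *)
From Stdlib Require Import Reals.
From Coquelicot Require Import Coquelicot.
Open Scope R_scope.

Definition dx (u : R -> R -> R) : R -> R -> R :=
  fun x t => Derive (fun y => u y t) x.

Definition dt (u : R -> R -> R) : R -> R -> R :=
  fun x t => Derive (fun s => u x s) t.

(* [Derive] is total, with an unspecified value where the derivative does not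
   exist, so differentiability at each stage is required explicitly.
   Continuity of the partial derivatives is joint continuity in (x, t). *)
Fixpoint Ck2 (k : nat) (u : R -> R -> R) : Prop :=
  match k with
  | O => forall x t, continuity_2d_pt u x t
  | S k' =>
      (forall x t, ex_derive (fun y => u y t) x
                   /\ ex_derive (fun s => u x s) t)
      /\ Ck2 k' (dx u) /\ Ck2 k' (dt u)
  end.

(* [ex_derive_n f n] only says that [Derive_n f (n - 1)] is differentiable, so
   it has to be required for all orders up to k. *)
Definition Ck1 (k : nat) (f : R -> R) : Prop :=
  (forall n x, (n <= k)%nat -> ex_derive_n f n x)
  /\ (forall x, continuous (Derive_n f k) x).

(* Classical solutions on the whole (x, t) plane of
   u_tt = (kappa u + gamma u^2)_xx + nu u u_xxxx + mu u_xxtt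
          + alpha u_x u_xxx + beta u_xx^2. *)
Definition pde_solution (alpha beta gamma mu nu kappa : R)
    (u : R -> R -> R) : Prop :=
  Ck2 4 u /\
  forall x t : R,
    dt (dt u) x t =
      dx (dx (fun y s => kappa * u y s + gamma * u y s ^ 2)) x t
      + nu * u x t * dx (dx (dx (dx u))) x t
      + mu * dt (dt (dx (dx u))) x t
      + alpha * dx u x t * dx (dx (dx u)) x t
      + beta * dx (dx u) x t ^ 2.

Definition travelling_wave (D : R) (H : R -> R) : R -> R -> R :=
  fun x t => H (x - D * t).

Definition profile_solution (mu kappa D : R) (H : R -> R) : Prop :=
  Ck1 4 H /\
  forall xi : R,
    mu * D ^ 2 * Derive_n H 4 xi + (kappa - D ^ 2) * Derive_n H 2 xi = 0.

Definition trig_profile (mu kappa D C1 C2 : R) : R -> R :=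
  fun xi => C1 * sin (sqrt ((kappa - D ^ 2) / (mu * D ^ 2)) * xi)
            + C2 * cos (sqrt ((kappa - D ^ 2) / (mu * D ^ 2)) * xi).

(* Main.v *)
Require Import Defs.
From Stdlib Require Import Reals.
From Coquelicot Require Import Coquelicot.
From Stdlib Require Import FunctionalExtensionality Lra Lia.
Open Scope R_scope.

(** With [H] of class C^4, every partial derivative of [H (x - D t)] is a
    derivative of [H] times a power of [- D], which turns the PDE into the
    profile equation.  For the general solution put
    [w ^ 2 = (kappa - D ^ 2) / (mu * D ^ 2)]: then [H''] solves
    [G'' = - w ^ 2 * G], hence is trigonometric, while [H + H'' / w ^ 2] has
    zero second derivative, hence is affine. *)

(** * Regularity classes in one variable *)

Lemma Ck1_0 (f : R -> R) : Ck1 0 f <-> forall x, continuous f x.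
Proof.
  split.
  - intros [_ Hc]; exact Hc.
  - intros Hc; split; [|exact Hc].
    intros n x Hn; replace n with 0%nat by lia; exact I.
Qed.

Lemma Derive_n_Derive (f : R -> R) (n : nat) :
  Derive_n (Derive f) n = Derive_n f (S n).
Proof.
  apply functional_extensionality; intros x.
  replace (S n) with (n + 1)%nat by lia.
  exact (Derive_n_comp f n 1 x).
Qed.

(** Gives [Ck1] the recursive shape of [Ck2], so that an induction on [k] can treat both at once. *)
Lemma Ck1_S (k : nat) (f : R -> R) :
  Ck1 (S k) f <-> (forall x, ex_derive f x) /\ Ck1 k (Derive f).
Proof.
  unfold Ck1; rewrite Derive_n_Derive; split.
  - intros [Hd Hc]; repeat split; try exact Hc.
    + intros x; apply (Hd 1%nat); lia.
    + intros [|n] x Hn; [exact I|].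
      simpl; rewrite Derive_n_Derive.
      apply (Hd (S (S n))); lia.
  - intros [H1 [Hd Hc]]; split; [|exact Hc].
    intros [|[|n]] x Hn; [exact I|apply H1|].
    specialize (Hd (S n) x ltac:(lia)); simpl in Hd.
    rewrite Derive_n_Derive in Hd; exact Hd.
Qed.

Lemma Derive_scal_fun (c : R) (f : R -> R) :
  Derive (fun x => c * f x) = (fun x => c * Derive f x).
Proof. apply functional_extensionality; intros x; apply Derive_scal. Qed.

Lemma Ck1_scal (k : nat) (c : R) (f : R -> R) :
  Ck1 k f -> Ck1 k (fun x => c * f x).
Proof.
  revert f; induction k as [|k IH]; intros f.
  - rewrite !Ck1_0; intros Hf x.
    exact (continuous_scal_r c f x (Hf x)).
  - rewrite !Ck1_S, Derive_scal_fun; intros [Hd Hf]; split.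
    + intros x; apply ex_derive_scal, Hd.
    + apply IH, Hf.
Qed.

(** * Partial derivatives of travelling waves, and reduction of the PDE *)

(** Both sides are limits of the same difference quotients, so even the default values of [Derive]
    agree and [H] may be arbitrary. *)
Lemma dx_travelling_wave (D : R) (H : R -> R) :
  dx (travelling_wave D H) = travelling_wave D (Derive H).
Proof.
  apply functional_extensionality; intros x.
  apply functional_extensionality; intros t.
  unfold dx, travelling_wave, Derive; f_equal; apply Lim_ext; intros h.
  now replace (x + h - D * t) with (x - D * t + h) by ring.
Qed.

Lemma dt_travelling_wave (D : R) (H : R -> R) :
  (forall x, ex_derive H x) ->
  dt (travelling_wave D H) = travelling_wave D (fun xi => - D * Derive H xi).
Proof.
  intros Hd.
  apply functional_extensionality; intros x.
  apply functional_extensionality; intros t.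
  unfold dt, travelling_wave; apply is_derive_unique.
  auto_derive; [apply Hd|].
  ring_simplify; reflexivity.
Qed.

Lemma Ck2_travelling_wave (k : nat) (D : R) (H : R -> R) :
  Ck2 k (travelling_wave D H) <-> Ck1 k H.
Proof.
  revert H; induction k as [|k IH]; intros H.
  - rewrite Ck1_0; simpl; split.
    + intros Hc x; apply continuity_pt_filterlim.
      intros eps Heps.
      (* On the slice [t = 0] the wave is [H] itself, so joint continuity there gives continuity of
         [H]. *)
      destruct (Hc x 0 (mkposreal eps Heps)) as [d Hball].
      exists d; split; [apply cond_pos|].
      intros y [_ Hy]; simpl in *; unfold R_dist in *.
      assert (Hb : Rabs (0 - 0) < d)
        by (rewrite Rminus_0_r, Rabs_R0; apply cond_pos).
      specialize (Hball y 0 Hy Hb); unfold travelling_wave in Hball.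
      now rewrite Rmult_0_r, !Rminus_0_r in Hball.
    + intros Hc x t.
      apply (continuity_1d_2d_pt_comp H (fun x t => x - D * t)).
      * apply continuity_pt_filterlim, Hc.
      * apply continuity_2d_pt_minus; [apply continuity_2d_pt_id1|].
        apply continuity_2d_pt_mult;
          [apply continuity_2d_pt_const|apply continuity_2d_pt_id2].
  - rewrite Ck1_S; cbn [Ck2]; rewrite dx_travelling_wave; split.
    + intros [Hd [Hx _]]; split; [|apply IH, Hx].
      intros x; destruct (Hd x 0) as [Hd0 _].
      apply ex_derive_ext with (2 := Hd0); intros y.
      unfold travelling_wave; f_equal; ring.
    + intros [Hd HC].
      rewrite dt_travelling_wave by exact Hd.
      split; [|split; apply IH; [|apply Ck1_scal]; exact HC].
      intros x t; unfold travelling_wave; split; auto_derive; apply Hd.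
Qed.

Lemma pde_solution_travelling_wave (mu kappa D : R) (H : R -> R) :
  pde_solution 0 0 0 mu 0 kappa (travelling_wave D H)
  <-> profile_solution mu kappa D H.
Proof.
  unfold pde_solution, profile_solution; rewrite Ck2_travelling_wave.
  (* The two equations are compared pointwise; every [xi] is reached by taking [x = xi], [t = 0]. *)
  enough (HE : Ck1 4 H -> forall x t,
    (dt (dt (travelling_wave D H)) x t =
      dx (dx (fun y s => kappa * travelling_wave D H y s
                         + 0 * travelling_wave D H y s ^ 2)) x t
      + 0 * travelling_wave D H x t
        * dx (dx (dx (dx (travelling_wave D H)))) x t
      + mu * dt (dt (dx (dx (travelling_wave D H)))) x t
      + 0 * dx (travelling_wave D H) x t
        * dx (dx (dx (travelling_wave D H))) x t
      + 0 * dx (dx (travelling_wave D H)) x t ^ 2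
     <-> mu * D ^ 2 * Derive_n H 4 (x - D * t)
         + (kappa - D ^ 2) * Derive_n H 2 (x - D * t) = 0)).
  { split; intros [HC Heq]; (split; [exact HC|]).
    - intros xi; specialize (HE HC xi 0).
      rewrite Rmult_0_r, Rminus_0_r in HE; apply HE, Heq.
    - intros x t; apply HE; auto. }
  intros HC x t.
  apply Ck1_S in HC as [H1 HC]; apply Ck1_S in HC as [H2 HC];
    apply Ck1_S in HC as [H3 HC]; apply Ck1_S in HC as [H4 _].
  (* With the quadratic term gone, the flux is again a travelling wave. *)
  assert (Hflux : (fun y s => kappa * travelling_wave D H y s
                             + 0 * travelling_wave D H y s ^ 2)
                  = travelling_wave D (fun xi => kappa * H xi)).
  { apply functional_extensionality; intros y.
    apply functional_extensionality; intros s.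
    unfold travelling_wave; ring. }
  (* Stated for general [f] because it serves twice: for [u_tt] with [f = H] and for [u_xxtt] with
     [f = H'']. *)
  assert (Hdtt : forall f, (forall x, ex_derive f x) ->
            (forall x, ex_derive (Derive f) x) ->
            dt (dt (travelling_wave D f)) x t
            = D ^ 2 * Derive (Derive f) (x - D * t)).
  { intros f Hf1 Hf2.
    rewrite dt_travelling_wave by exact Hf1.
    rewrite dt_travelling_wave by (intros z; apply ex_derive_scal, Hf2).
    unfold travelling_wave; rewrite Derive_scal; ring. }
  rewrite Hflux, !dx_travelling_wave, !Hdtt by assumption.
  rewrite !Derive_scal_fun; unfold travelling_wave.
  change (Derive_n H 4) with (Derive (Derive (Derive (Derive H)))).
  change (Derive_n H 2) with (Derive (Derive H)).
  split; intros Heq; lra.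
Qed.

(** * Trigonometric profiles solve the equation *)

Lemma is_derive_trig (w a b x : R) :
  is_derive (fun x => a * sin (w * x) + b * cos (w * x)) x
    (- b * w * sin (w * x) + a * w * cos (w * x)).
Proof. auto_derive; [exact I|ring]. Qed.

Lemma Derive_trig (w a b : R) :
  Derive (fun x => a * sin (w * x) + b * cos (w * x))
  = (fun x => - b * w * sin (w * x) + a * w * cos (w * x)).
Proof.
  apply functional_extensionality; intros x.
  apply is_derive_unique, is_derive_trig.
Qed.

(** Differentiation maps the coefficients [(a, b)] to [(- b * w, a * w)], so the family is closed
    under it and the induction must let both vary. *)
Lemma Ck1_trig (k : nat) (w a b : R) :
  Ck1 k (fun x => a * sin (w * x) + b * cos (w * x)).
Proof.
  assert (Hd : forall a b x,
             ex_derive (fun x => a * sin (w * x) + b * cos (w * x)) x)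
    by (intros; eexists; apply is_derive_trig).
  revert a b; induction k as [|k IH]; intros a b.
  - apply Ck1_0; intros x; apply (ex_derive_continuous (V := R_NormedModule)), Hd.
  - apply Ck1_S; split; [apply Hd|rewrite Derive_trig; apply IH].
Qed.

Lemma trig_profile_solution (mu kappa D C1 C2 : R) :
  mu <> 0 -> D <> 0 -> 0 <= (kappa - D ^ 2) / (mu * D ^ 2) ->
  profile_solution mu kappa D (trig_profile mu kappa D C1 C2).
Proof.
  intros Hmu HD Hpos.
  split; [apply Ck1_trig|].
  intros xi; unfold trig_profile.
  pose proof (sqrt_sqrt _ Hpos) as Hw.
  set (w := sqrt _) in *.
  assert (Hk : kappa - D ^ 2 = mu * D ^ 2 * (w * w))
    by (rewrite Hw; field; auto).
  simpl Derive_n; rewrite !Derive_trig, Hk; ring.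
Qed.

(** * General solution of the profile equation *)

Lemma is_derive_0_const (f : R -> R) :
  (forall x, is_derive f x 0) -> forall x, f x = f 0.
Proof.
  intros Hf x.
  destruct (Rtotal_order x 0) as [Hx|[->|Hx]]; [|reflexivity|].
  - apply (eq_is_derive f x 0); auto.
  - symmetry; apply (eq_is_derive f 0 x); auto.
Qed.

(** The vector [(g, g' / w)] turns at constant rate [w]. Undoing this rotation gives two
    combinations with zero derivative, equal to their values at 0. *)
Lemma harmonic_trig (w : R) (g g' : R -> R) :
  w <> 0 ->
  (forall x, is_derive g x (g' x)) ->
  (forall x, is_derive g' x (- w ^ 2 * g x)) ->
  forall x, g x = g' 0 / w * sin (w * x) + g 0 * cos (w * x).
Proof.
  intros Hw Hg Hg' x.
  assert (HP : forall x, g x * sin (w * x) + g' x / w * cos (w * x) = g' 0 / w).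
  { intros y.
    rewrite (is_derive_0_const
               (fun x => g x * sin (w * x) + g' x / w * cos (w * x))).
    - rewrite Rmult_0_r, sin_0, cos_0; ring.
    - intros z; auto_derive.
      + repeat split; eexists; [apply Hg|apply Hg'].
        change (fun x => g x) with g; change (fun x => g' x) with g'.
        rewrite (is_derive_unique g z _ (Hg z)),
                (is_derive_unique g' z _ (Hg' z)).
        field; auto. }
  assert (HQ : forall x, g x * cos (w * x) - g' x / w * sin (w * x) = g 0).
  { intros y.
    rewrite (is_derive_0_const
               (fun x => g x * cos (w * x) - g' x / w * sin (w * x))).
    - rewrite Rmult_0_r, sin_0, cos_0; ring.
    - intros z; auto_derive.
      + repeat split; eexists; [apply Hg|apply Hg'].
        change (fun x => g x) with g; change (fun x => g' x) with g'.
        rewrite (is_derive_unique g z _ (Hg z)),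
                (is_derive_unique g' z _ (Hg' z)).
        field; auto. }
  (* Rotating back: [g] is the first invariant times the sine plus the second times the cosine. *)
  rewrite <- (HP x), <- (HQ x).
  pose proof (sin2_cos2 (w * x)) as Hsc; unfold Rsqr in Hsc.
  transitivity (g x * (sin (w * x) * sin (w * x) + cos (w * x) * cos (w * x)));
    [rewrite Hsc|]; ring.
Qed.

(** As [f'] is constant, subtracting [f' 0 * x] from [f] leaves a function with zero derivative. *)
Lemma affine_of_second_derivative_0 (f f' : R -> R) :
  (forall x, is_derive f x (f' x)) -> (forall x, is_derive f' x 0) ->
  forall x, f x = f 0 + f' 0 * x.
Proof.
  intros Hf Hf' x.
  enough (Hc : f x - f' 0 * x = f 0 - f' 0 * 0) by lra.
  apply (is_derive_0_const (fun x => f x - f' 0 * x)); intros y.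
  auto_derive; [eexists; apply Hf|].
  change (fun x => f x) with f.
  rewrite (is_derive_unique f y _ (Hf y)), (is_derive_0_const f' Hf' y); ring.
Qed.

Lemma profile_solution_general (mu kappa D : R) (H : R -> R) :
  mu <> 0 -> D <> 0 -> 0 < (kappa - D ^ 2) / (mu * D ^ 2) ->
  profile_solution mu kappa D H ->
  exists C1 C2 A B : R, forall xi : R,
    H xi = trig_profile mu kappa D C1 C2 xi + (A + B * xi).
Proof.
  intros Hmu HD Hpos [HC Heq].
  pose proof (sqrt_sqrt _ (Rlt_le _ _ Hpos)) as Hw2.
  pose proof (sqrt_lt_R0 _ Hpos) as Hw.
  unfold trig_profile; set (w := sqrt _) in *.
  assert (Hd : forall n x, (n < 4)%nat ->
             is_derive (Derive_n H n) x (Derive_n H (S n) x)).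
  { intros n x Hn; apply Derive_correct.
    exact (proj1 HC (S n) x ltac:(lia)). }
  (* Dividing the profile equation by [mu * D ^ 2] gives [H'''' = - w ^ 2 * H'']. *)
  assert (HG : forall x, is_derive (Derive_n H 3) x (- w ^ 2 * Derive_n H 2 x)).
  { intros x.
    replace (- w ^ 2 * Derive_n H 2 x) with (Derive_n H 4 x);
      [apply Hd; lia|].
    assert (Hk : kappa - D ^ 2 = mu * D ^ 2 * w ^ 2)
      by (replace (w ^ 2) with (w * w) by ring; rewrite Hw2; field; auto).
    specialize (Heq x); rewrite Hk in Heq.
    assert (HmD : mu * D ^ 2 <> 0)
      by (apply Rmult_integral_contrapositive; split;
          [|apply pow_nonzero]; assumption).
    apply (Rmult_eq_reg_l (mu * D ^ 2)); [lra|exact HmD]. }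
  pose proof (harmonic_trig w (Derive_n H 2) (Derive_n H 3)
                ltac:(lra) (fun x => Hd 2%nat x ltac:(lia)) HG) as Htrig.
  pose proof (affine_of_second_derivative_0
    (fun x => H x + / w ^ 2 * Derive_n H 2 x)
    (fun x => Derive_n H 1 x + / w ^ 2 * Derive_n H 3 x)) as Haff.
  assert (Hlin : forall f g (x a b : R), is_derive f x a -> is_derive g x b ->
            is_derive (fun x => f x + / w ^ 2 * g x) x (a + / w ^ 2 * b)).
  { intros f g x a b Hf Hg.
    exact (is_derive_plus f (fun x => / w ^ 2 * g x) x a _ Hf
             (is_derive_scal g x (/ w ^ 2) b Hg)). }
  specialize (Haff (fun x => Hlin _ _ x _ _ (Hd 0%nat x ltac:(lia))
                                       (Hd 2%nat x ltac:(lia)))).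
  assert (Hzero : forall x, is_derive
            (fun x => Derive_n H 1 x + / w ^ 2 * Derive_n H 3 x) x 0).
  { intros x.
    replace 0 with (Derive_n H 2 x + / w ^ 2 * (- w ^ 2 * Derive_n H 2 x))
      by (field; lra).
    apply Hlin; [apply (Hd 1%nat); lia|apply HG]. }
  specialize (Haff Hzero).
  (* Since [H = (H + H'' / w ^ 2) - H'' / w ^ 2], the trigonometric coefficients are those of [H'']
     times [- / w ^ 2], and [A], [B] are the value and slope at 0 of the affine part. *)
  exists (- / w ^ 2 * (Derive_n H 3 0 / w)), (- / w ^ 2 * Derive_n H 2 0),
         (H 0 + / w ^ 2 * Derive_n H 2 0),
         (Derive_n H 1 0 + / w ^ 2 * Derive_n H 3 0).
  intros xi; rewrite <- Haff, (Htrig xi); ring.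
Qed.

(* The trigonometric functions alone do not exhaust the solutions of the
   fourth-order equation: its general solution also contains an affine term,
   which the last clause makes explicit. *)
Theorem mainTheorem2 (alpha beta gamma mu nu kappa : R)
    (hnu : nu = 0) (halpha : alpha = 0) (hbeta : beta = 0) (hgamma : gamma = 0)
    (D : R) :
  (forall H : R -> R,
     pde_solution alpha beta gamma mu nu kappa (travelling_wave D H)
     <-> profile_solution mu kappa D H)
  /\ (mu <> 0 -> D <> 0 -> 0 <= (kappa - D ^ 2) / (mu * D ^ 2) ->
      forall C1 C2 : R,
        profile_solution mu kappa D (trig_profile mu kappa D C1 C2)
        /\ pde_solution alpha beta gamma mu nu kappa
             (fun x t =>
                C1 * sin (sqrt ((kappa - D ^ 2) / (mu * D ^ 2)) * (x - D * t))
                + C2 * cos (sqrt ((kappa - D ^ 2) / (mu * D ^ 2)) * (x - D * t))))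
  /\ (mu <> 0 -> D <> 0 -> 0 < (kappa - D ^ 2) / (mu * D ^ 2) ->
      forall H : R -> R,
        profile_solution mu kappa D H ->
        exists C1 C2 A B : R, forall xi : R,
          H xi = trig_profile mu kappa D C1 C2 xi + (A + B * xi)).
Proof.
  subst; split; [|split].
  - apply pde_solution_travelling_wave.
  - intros Hmu HD Hpos C1 C2.
    pose proof (trig_profile_solution mu kappa D C1 C2 Hmu HD Hpos) as Hp.
    split; [exact Hp|].
    (* The explicit formula is convertible to the travelling wave of [trig_profile]. *)
    exact (proj2 (pde_solution_travelling_wave mu kappa D _) Hp).
  - intros Hmu HD Hpos H; apply profile_solution_general; assumption.
Qed.
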